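(* Let $(\Omega,\mathcal{F},P)$ be a probability space, let $(B,\|\cdot\|)$ be a Banach space over $K$ (where $K=\mathbb{R}$ or $K=\mathbb{C}$), and let $V\subset B$ be a weakly compact convex subset with normal structure. Then $L^0(\mathcal{F},V)$, the set of equivalence classes of $V$-valued strong $\mathcal{F}$-random elements on $(\Omega,\mathcal{F},P)$, as a closed $L^0$-convex subset of $L^0(\mathcal{F},B)$, has random normal structure.
   Context: Random elements: for a metric space $M$, a map $X:\Omega\to M$ is an $\mathcal{F}$-random element if $X^{-1}(G)\in\mathcal{F}$ for every open $G\subset M$; it is simple if in addition it takes only finitely many values; it is a strong $\mathcal{F}$-random element if it is the pointwise limit of a sequence of simple random elements (equivalently, it is a random element with separable range). Two random elements are equivalent if they agree $P$-almost everywhere. $L^0(\mathcal{F},K)$ is the algebra of equivalence classes of $K$-valued $\mathcal{F}$-measurable random variables, $L^0(\mathcal{F})=L^0(\mathcal{F},\mathbb{R})$, and $\bar L^0(\mathcal{F})$ is the set of equivalence classes of extended real-valued $\mathcal{F}$-measurable random variables. The order is $\xi\le\eta$ iff $\xi^0\le\eta^0$ $P$-a.s. for representatives $\xi^0,\eta^0$; with it $\bar L^0(\mathcal{F})$ is a complete lattice, and $\bigvee H$ denotes the supremum of $H\subset\bar L^0(\mathcal{F})$ (the essential supremum). $L^0_+(\mathcal{F})=\{\xi\in L^0(\mathcal{F}):\xi\ge0\}$. $\xi<\eta$ means $\xi\le\eta$ and $\xi\ne\eta$; for $A\in\mathcal{F}$, ''$\xi<\eta$ on $A$'' means $\xi^0(\omega)<\eta^0(\omega)$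 for $P$-almost all $\omega\in A$; $(\xi>0)$ denotes the set $\{\omega:\xi^0(\omega)>0\}$ (defined up to a null set). $L^0(\mathcal{F},B)$ is the set of equivalence classes of $B$-valued strong $\mathcal{F}$-random elements on $\Omega$. It is an $L^0(\mathcal{F},K)$-module under pointwise operations, with the $L^0$-norm $\|x\|:=$ the class of $\omega\mapsto\|x^0(\omega)\|$ in $L^0_+(\mathcal{F})$, where $x^0$ is a representative of $x$. It is endowed with the $(\varepsilon,\lambda)$-topology, the linear topology with local base at $0$ given by the sets $\{x: P\{\omega:\|x\|(\omega)<\varepsilon\}>1-\lambda\}$, $\varepsilon>0$, $0<\lambda<1$; this is the topology of convergence in probability. ''Closed'' for subsets of $L^0(\mathcal{F},B)$ refers to this topology. A subset $G$ of $L^0(\mathcal{F},B)$ is $L^0$-convex if $\xi x+\eta y\in G$ for all $x,y\in G$ and all $\xi,\eta\in L^0_+(\mathcal{F})$ with $\xi+\eta=1$. Normal structure: a nonempty closed convex subset $V$ of $B$ has normal structure if for each bounded closed convex subset $H$ of $V$ with $\mathrm{Diam}(H):=\sup\{\|h_1-h_2\|:h_1,h_2\in H\}>0$ there exists $h_0\in H$ such that $\sup\{\|h_0-h\|:h\in H\}<\mathrm{Diam}(H)$. Random normal structure: for a nonempty subset $H$ of $L^0(\mathcal{F},B)$ let $D(H):=\bigvee\{\|h_1-h_2\|:h_1,h_2\in H\}$ (the random diameter); $H$ is a.s. bounded if $\bigvee\{\|h\|:h\in H\}\in L^0_+(\mathcal{F})$, equivalently $D(H)\in L^0_+(\mathcal{F})$.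 A nonempty closed $L^0$-convex subset $G$ of $L^0(\mathcal{F},B)$ has random normal structure if for each closed a.s. bounded $L^0$-convex subset $H$ of $G$ with $D(H)>0$ there exists $h_0\in H$ such that $\bigvee\{\|h_0-h\|:h\in H\}<D(H)$ on $(D(H)>0)$. *)

(* Defs.v *)
From HB Require Import structures.
From mathcomp Require Import all_boot all_order all_algebra generic_quotient.
From mathcomp Require Import complex.
From mathcomp Require Import all_classical all_reals all_analysis.
From mathcomp Require Import measurable_realfun.

Set Implicit Arguments.
Unset Strict Implicit.
Unset Printing Implicit Defensive.

Import Order.TTheory GRing.Theory Num.Theory numFieldNormedType.Exports.

Local Open Scope classical_set_scope.
Local Open Scope ring_scope.
Local Open Scope quotient_scope.

Inductive scalars := RealScalars | ComplexScalars.

Definition scalar_field (R : realType) (k : scalars) : numFieldType :=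
  match k with RealScalars => R | ComplexScalars => R[i] end.

Definition inK (R : realType) (k : scalars) : R -> scalar_field R k :=
  match k return R -> scalar_field R k with
  | RealScalars => id
  | ComplexScalars => fun a => (a%:C)%C
  end.

Definition reK (R : realType) (k : scalars) : scalar_field R k -> R :=
  match k return scalar_field R k -> R with
  | RealScalars => id
  | ComplexScalars => @complex.Re R
  end.

(* The norm of a [normedModType K] takes its (real) values in [K]; [rnorm] is  *)
(* the same norm with values in [R].                                           *)
Definition rnorm (R : realType) (k : scalars)
  (B : normedModType (scalar_field R k)) (x : B) : R := reK `|x|.

Section scalars_theory.
Context {R : realType} {k : scalars}.
Local Notation K := (scalar_field R k).

Lemma reK_inK (a : R) : reK (inK k a) = a.
Proof. by case: k. Qed.

Lemma inK_reK (x : K) : 0 <= x -> inK k (reK x) = x.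
Proof.
case: k x => //= -[a b] /=.
by rewrite lecE/= => /andP[/eqP -> _].
Qed.

Lemma inK_le (a b : R) : (inK k a <= inK k b) = (a <= b).
Proof. by case: k => //=; rewrite lecR. Qed.

Lemma inK_lt (a b : R) : (inK k a < inK k b) = (a < b).
Proof. by rewrite !lt_leAnge !inK_le. Qed.

Lemma inKD (a b : R) : inK k (a + b) = inK k a + inK k b.
Proof. by case: k => //=; rewrite rmorphD. Qed.

Lemma inKB (a b : R) : inK k (a - b) = inK k a - inK k b.
Proof. by case: k => //=; rewrite rmorphB. Qed.

Lemma inKM (a b : R) : inK k (a * b) = inK k a * inK k b.
Proof. by case: k => //=; rewrite rmorphM. Qed.

Lemma inK1 : inK k (1 : R) = 1.
Proof. by case: k. Qed.

Lemma inK0 : inK k (0 : R) = 0.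
Proof. by case: k. Qed.

Lemma norm_inK (a : R) : `|inK k a| = inK k `|a|.
Proof. by case: k => //=; rewrite normc_def/= expr0n/= addr0 sqrtr_sqr. Qed.

Context {B : normedModType K}.
Implicit Types x y : B.

Lemma inK_rnorm x : inK k (rnorm x) = `|x|.
Proof. by rewrite /rnorm inK_reK. Qed.

Lemma rnorm_ge0 x : 0 <= rnorm x.
Proof. by rewrite -(inK_le 0) inK_rnorm inK0. Qed.

Lemma rnorm0 : rnorm (0 : B) = 0.
Proof. by rewrite /rnorm normr0; case: (k). Qed.

Lemma rnormN x : rnorm (- x) = rnorm x.
Proof. by rewrite /rnorm normrN. Qed.

Lemma rnormD x y : rnorm (x + y) <= rnorm x + rnorm y.
Proof. by rewrite -inK_le inKD !inK_rnorm ler_normD. Qed.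

Lemma rnorm_dist x y : `|rnorm x - rnorm y| <= rnorm (x - y).
Proof.
rewrite ler_norml lerBlDr lerBrDr addrC.
have := rnormD (x - y) y; rewrite subrK => -> /=.
have := rnormD (y - x) x.
by rewrite subrK -[rnorm (y - x)]rnormN opprB andbT lerBlDl addrC.
Qed.

Lemma inK_continuous : continuous (inK k : R -> K^o).
Proof.
move=> a; apply/cvgrPdist_lt => e e0.
have eE : inK k (reK e) = e by rewrite inK_reK// ltW.
have re0 : 0 < reK e by rewrite -inK_lt inK0 eE.
near=> b; rewrite -inKB norm_inK -eE inK_lt.
by near: b; apply: cvgr_dist_lt => //; exact: cvg_id.
Unshelve. all: by end_near. Qed.

Lemma rnorm_continuous : continuous (@rnorm R k B).
Proof.
move=> x; apply/cvgrPdist_lt => e e0.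
have ie0 : 0 < inK k e by rewrite -inK0 inK_lt.
near=> y; apply: (le_lt_trans (rnorm_dist _ _)).
rewrite -inK_lt inK_rnorm.
by near: y; apply: cvgr_dist_lt => //; exact: cvg_id.
Unshelve. all: by end_near. Qed.

End scalars_theory.

Definition dual (K : numFieldType) (B : normedModType K) :=
  {f : {linear B -> K^o} | continuous (f : B -> K^o)}.

(* B with its weak topology: the coarsest topology making all the continuous   *)
(* linear functionals on B continuous.                                         *)
Definition weak_space (K : numFieldType) (B : normedModType K) :
    topologicalType :=
  sup_topology (fun f : dual B =>
    Topological.on (initial_topology (sval f : B -> K^o))).

Definition weakly_compact (K : numFieldType) (B : normedModType K) (V : set B) :=
  compact (V : set (weak_space B)).

Section normal_structure.
Context {R : realType} {k : scalars} {B : normedModType (scalar_field R k)}.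

Definition diam (H : set B) : R := sup [set rnorm (h1 - h2) | h1 in H & h2 in H].

Definition normal_structure (V : set B) :=
  [/\ V !=set0, closed V, convex_set V &
      forall H : set B, H `<=` V -> bounded_set H -> closed H -> convex_set H ->
        0 < diam H ->
        exists2 h0, H h0 & sup [set rnorm (h0 - h) | h in H] < diam H].

End normal_structure.

Section random_elements.
Context d (T : measurableType d).

Definition random_element (M : topologicalType) (X : T -> M) :=
  forall G : set M, open G -> measurable (X @^-1` G).

Definition simple_random_element (M : topologicalType) (X : T -> M) :=
  random_element X /\ finite_set (range X).

Definition strong_random_element (M : topologicalType) (X : T -> M) :=
  exists2 s : (T -> M)^nat, (forall n, simple_random_element (s n)) &
    forall t, s ^~ t @ \oo --> X t.

Lemma simple_fiber (M : topologicalType) (X : T -> M) a : accessible_space M ->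
  simple_random_element X -> measurable (X @^-1` [set a]).
Proof.
move=> M1 [rX _]; rewrite -[X in measurable X]setCK.
apply: measurableC; apply: (rX (~` [set a])); rewrite openC.
exact: accessible_closed_set1.
Qed.

Lemma simple_comp2 (M1 M2 M3 : topologicalType) (op : M1 -> M2 -> M3) X Y :
  accessible_space M1 -> accessible_space M2 ->
  simple_random_element X -> simple_random_element Y ->
  simple_random_element (fun t => op (X t) (Y t)).
Proof.
move=> a1 a2 sX sY; split; last first.
  apply: (@sub_finite_set _ _ [set op x y | x in range X & y in range Y]).
    by move=> _ [t _ <-]; exists (X t); [exists t|exists (Y t); [exists t|]].
  by apply: finite_image2; [case: sX|case: sY].
move=> G _.
rewrite (_ : _ @^-1` _ = \bigcup_(x in range X) \bigcup_(y in range Y)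
    [set t | [/\ G (op x y), X t = x & Y t = y]]); last first.
  apply/seteqP; split => t /=.
    by move=> Gt; exists (X t); [exists t|exists (Y t); [exists t|]].
  by move=> [x _ [y _ [+ Xt Yt]]]; rewrite Xt Yt.
apply: fin_bigcup_measurable; first by case: sX.
move=> x _; apply: fin_bigcup_measurable; first by case: sY.
move=> y _; have [Gxy|nGxy] := pselect (G (op x y)).
  rewrite (_ : mkset _ = X @^-1` [set x] `&` Y @^-1` [set y]).
    by apply: measurableI; exact: simple_fiber.
  by apply/seteqP; split => t [].
by rewrite (_ : mkset _ = set0)//; apply/seteqP; split => t [].
Qed.

Lemma strong_comp2 (M1 M2 M3 : topologicalType) (op : M1 -> M2 -> M3) X Y :
  accessible_space M1 -> accessible_space M2 ->
  continuous (fun z => op z.1 z.2) ->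
  strong_random_element X -> strong_random_element Y ->
  strong_random_element (fun t => op (X t) (Y t)).
Proof.
move=> a1 a2 cop [s ss sX] [u su uY].
exists (fun n t => op (s n t) (u n t)) => [n|t]; first exact: simple_comp2.
by apply: continuous2_cvg (sX t) (uY t); exact: cop (X t, Y t).
Qed.

Lemma strong_comp (M1 M2 : topologicalType) (f : M1 -> M2) X :
  continuous f -> strong_random_element X ->
  strong_random_element (fun t => f (X t)).
Proof.
move=> cf [s ss sX]; exists (fun n t => f (s n t)) => [n|t]; last first.
  by apply: continuous_cvg; [exact: cf|exact: sX].
have [rs fs] := ss n; split.
  move=> G oG; apply: (rs (f @^-1` G)).
  by apply: open_comp => // x _; exact: cf.
by rewrite -(image_comp (s n) f); exact: finite_image.
Qed.

Lemma strong_cst (M : topologicalType) (a : M) : strong_random_element (fun=> a).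
Proof.
exists (fun _ _ => a) => [_|t]; last exact: cvg_cst.
split; last first.
  by apply: (@sub_finite_set _ _ [set a]) => // _ [t _ <-].
move=> G _; rewrite (_ : _ @^-1` _ = [set t | G a])//.
by have [Ga|Ga] := pselect (G a); [rewrite (_ : mkset _ = setT)|
  rewrite (_ : mkset _ = set0)] => //; apply/seteqP; split.
Qed.

Lemma strong_measurable (R : realType) (f : T -> R) :
  strong_random_element f -> measurable_fun setT f.
Proof.
move=> [s ss sf]; apply: (@measurable_fun_cvg _ _ _ setT s) => [n|t _];
  last exact: sf.
have [rs _] := ss n.
apply: (measurability (@RGenOpens.G R)) => [|_ [_ [x [y ->]] <-]].
  exact: RGenOpens.measurableE.
by rewrite setTI; apply: rs; exact: interval_open.
Qed.

Import HBSimple.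

Lemma measurable_strong (R : realType) (f : T -> R) :
  measurable_fun setT f -> strong_random_element f.
Proof.
move=> mf; have mEf : measurable_fun setT (EFin \o f) by exact/measurable_EFinP.
have [g gf] := approximation_sfun measurableT mEf.
exists (fun n => g n : T -> R) => [n|t]; last first.
  by have /fine_cvgP[] := gf t I.
split; last exact: fimfunP.
by move=> G oG; apply: measurable_funPTI; exact: open_measurable.
Qed.

End random_elements.

Record strongRE d (T : measurableType d) (M : topologicalType) := StrongRE {
  sre_fun :> T -> M;
  sreP : strong_random_element sre_fun }.

HB.instance Definition _ d (T : measurableType d) (M : topologicalType) :=
  gen_eqMixin (strongRE T M).
HB.instance Definition _ d (T : measurableType d) (M : topologicalType) :=
  gen_choiceMixin (strongRE T M).

Section L0.
Context d (T : measurableType d) (R : realType) (P : probability T R).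
Variable M : topologicalType.

Definition equivalent_sre (X Y : strongRE T M) :=
  `[< {ae P, forall t, X t = Y t} >].

Local Lemma equivalent_refl : reflexive equivalent_sre.
Proof. by move=> X; apply/asboolP; exact: aeW. Qed.

Local Lemma equivalent_sym : symmetric equivalent_sre.
Proof. by move=> X Y; apply/idP/idP => /asboolP e; apply/asboolP;
  apply: filterS e => t ->. Qed.

Local Lemma equivalent_trans : transitive equivalent_sre.
Proof.
move=> Y X Z /asboolP XY /asboolP YZ; apply/asboolP.
by apply: filterS2 XY YZ => t -> ->.
Qed.

Canonical equivalent_sre_rel := EquivRel equivalent_sre
  equivalent_refl equivalent_sym equivalent_trans.

Definition L0 : Type := {eq_quot equivalent_sre}.
HB.instance Definition _ := Choice.on L0.
HB.instance Definition _ := EqQuotient.on L0.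

Definition L0_fun (x : L0) : T -> M := repr x.
Coercion L0_fun : L0 >-> Funclass.

Lemma L0_piE (X : strongRE T M) : {ae P, forall t, (\pi_L0 X : L0) t = X t}.
Proof. by apply/asboolP/(@eqquotP _ _ L0); rewrite reprK. Qed.

Lemma L0_eqP (x y : L0) : x = y <-> {ae P, forall t, x t = y t}.
Proof.
split=> [->|xy]; first exact: aeW.
by rewrite -(reprK x) -(reprK y); apply/eqquotP; exact/asboolP.
Qed.

End L0.


Section extended_random_variables.
Context d (T : measurableType d) (R : realType) (P : probability T R).

Local Notation L0bar := {mfun_ P, T >-> \bar R}.

Lemma mfun_piE d' (Y : measurableType d') (f : {mfun T >-> Y}) :
  {ae P, forall t, (\pi_{mfun_ P, T >-> Y} f : {mfun_ P, T >-> Y}) t = f t}.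
Proof.
have /eqquotP/asboolP :
    repr (\pi_{mfun_ P, T >-> Y} f) = f %[mod {mfun_ P, T >-> Y}].
  by rewrite reprK.
by apply: filterS => t; exact.
Qed.

Lemma mfun_eqP d' (Y : measurableType d') (x y : {mfun_ P, T >-> Y}) :
  x = y <-> {ae P, forall t, x t = y t}.
Proof.
split=> [->|xy]; first exact: aeW.
rewrite -(reprK x) -(reprK y); apply/eqquotP/asboolP.
by apply: filterS xy.
Qed.

Definition L0bar_le (xi eta : L0bar) :=
  `[< {ae P, forall t, (xi t <= eta t)%E} >].

Local Lemma L0bar_le_refl : reflexive L0bar_le.
Proof. by move=> xi; apply/asboolP; apply: aeW => t. Qed.

Local Lemma L0bar_le_anti : antisymmetric L0bar_le.
Proof.
move=> xi eta /andP[/asboolP le /asboolP ge]; apply/mfun_eqP.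
by apply: filterS2 le ge => t le ge; apply/le_anti; rewrite le ge.
Qed.

Local Lemma L0bar_le_trans : transitive L0bar_le.
Proof.
move=> eta xi zeta /asboolP le1 /asboolP le2; apply/asboolP.
by apply: filterS2 le1 le2 => t; exact: le_trans.
Qed.

Fact L0bar_display : Order.disp_t. Proof. exact: Order.Disp tt tt. Qed.

HB.instance Definition _ := Order.Le_isPOrder.Build L0bar_display L0bar
  L0bar_le_refl L0bar_le_anti L0bar_le_trans.

Definition L0bar_cst (a : \bar R) : L0bar :=
  \pi_L0bar (cst a : {mfun T >-> \bar R}).

(* Essential suprema exist in L0bar for every H and that of the empty set is   *)
(* the class of -oo, so [supremum] never returns an arbitrary default value.   *)
Definition bigvee (H : set L0bar) : L0bar := supremum (L0bar_cst -oo) H.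

(* Independent of the representatives chosen by the coercion to functions.     *)
Definition lt_on (A : set T) (xi eta : L0bar) :=
  {ae P, forall t, A t -> (xi t < eta t)%E}.

End extended_random_variables.

Section real_random_variables.
Context d (T : measurableType d) (R : realType) (P : probability T R).

Local Notation L0R := {mfun_ P, T >-> R}.

Definition L0R_cst (a : R) : L0R := \pi_L0R (cst a : {mfun T >-> R}).

Definition L0R_add (xi eta : L0R) : L0R := \pi_L0R (repr xi + repr eta).

Lemma L0R_addE xi eta : {ae P, forall t, L0R_add xi eta t = xi t + eta t}.
Proof. exact: mfun_piE. Qed.

Definition L0R_plus : set L0R := [set xi | {ae P, forall t, 0 <= xi t}].

Lemma measurable_EFin_comp (f : {mfun T >-> R}) :
  measurable_fun setT (EFin \o f).
Proof. exact/measurable_EFinP. Qed.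

Definition L0bar_of (xi : L0R) : {mfun_ P, T >-> \bar R} :=
  \pi_{mfun_ P, T >-> \bar R}
    (mfun_Sub (mem_set (measurable_EFin_comp (repr xi)))).

Lemma L0bar_ofE xi : {ae P, forall t, L0bar_of xi t = (xi t)%:E}.
Proof. exact: mfun_piE. Qed.

End real_random_variables.

Section L0_banach.
Context d (T : measurableType d) (R : realType) (P : probability T R).
Context {k : scalars} (B : normedModType (scalar_field R k)).

Lemma normed_accessible (K : numFieldType) (M : normedModType K) :
  accessible_space M.
Proof. exact/hausdorff_accessible/norm_hausdorff. Qed.

Lemma strong_add (X Y : T -> B) : strong_random_element X ->
  strong_random_element Y -> strong_random_element (fun t => X t + Y t).
Proof.
apply: strong_comp2; try exact: normed_accessible.
by move=> z; exact: add_continuous.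
Qed.

Lemma strong_opp (X : T -> B) :
  strong_random_element X -> strong_random_element (fun t => - X t).
Proof. by apply: strong_comp; exact: opp_continuous. Qed.

Lemma strong_scale (f : {mfun T >-> R}) (X : T -> B) :
  strong_random_element X ->
  strong_random_element (fun t => inK k (f t) *: X t).
Proof.
move=> sX; have sf : strong_random_element f by exact: measurable_strong.
apply: (@strong_comp2 _ _ _ _ _ (fun a x => inK k a *: x)) sf sX.
- exact: (@normed_accessible R R^o).
- exact: normed_accessible.
- move=> z; apply: cvgZ; last exact: cvg_snd.
  by apply: continuous_comp; [exact: cvg_fst|exact: inK_continuous].
Qed.

Lemma measurable_rnorm (X : T -> B) : strong_random_element X ->
  measurable_fun setT (fun t => rnorm (X t)).
Proof.
move=> sX; apply: strong_measurable; apply: strong_comp sX.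
exact: rnorm_continuous.
Qed.

Definition L0_zero : L0 P B := \pi_(L0 P B) (StrongRE (strong_cst T (0 : B))).

Definition L0_opp (x : L0 P B) : L0 P B :=
  \pi_(L0 P B) (StrongRE (strong_opp (sreP (repr x)))).

Definition L0_add (x y : L0 P B) : L0 P B :=
  \pi_(L0 P B) (StrongRE (strong_add (sreP (repr x)) (sreP (repr y)))).

(* Multiplication by a real-valued random variable, i.e. the restriction to    *)
(* L^0(F,R) of the L^0(F,K)-module structure of L^0(F,B).                      *)
Definition L0_scale (xi : {mfun_ P, T >-> R}) (x : L0 P B) : L0 P B :=
  \pi_(L0 P B) (StrongRE (strong_scale (repr xi) (sreP (repr x)))).

Lemma L0_zeroE : {ae P, forall t, L0_zero t = 0}.
Proof. exact: L0_piE. Qed.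

Lemma L0_oppE x : {ae P, forall t, L0_opp x t = - x t}.
Proof. exact: L0_piE. Qed.

Lemma L0_addE x y : {ae P, forall t, L0_add x y t = x t + y t}.
Proof. exact: L0_piE. Qed.

Lemma L0_scaleE xi x : {ae P, forall t, L0_scale xi x t = inK k (xi t) *: x t}.
Proof. exact: L0_piE. Qed.

Local Lemma L0_addA : associative L0_add.
Proof.
move=> x y z; apply/L0_eqP; near=> t.
rewrite (near (L0_addE x (L0_add y z)))// (near (L0_addE y z))//.
by rewrite (near (L0_addE (L0_add x y) z))// (near (L0_addE x y))// addrA.
Unshelve. all: by end_near. Qed.

Local Lemma L0_addC : commutative L0_add.
Proof.
move=> x y; apply/L0_eqP; near=> t.
by rewrite (near (L0_addE x y))// (near (L0_addE y x))// addrC.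
Unshelve. all: by end_near. Qed.

Local Lemma L0_add0 : left_id L0_zero L0_add.
Proof.
move=> x; apply/L0_eqP; near=> t.
by rewrite (near (L0_addE L0_zero x))// (near L0_zeroE)// add0r.
Unshelve. all: by end_near. Qed.

Local Lemma L0_addN : left_inverse L0_zero L0_opp L0_add.
Proof.
move=> x; apply/L0_eqP; near=> t.
rewrite (near (L0_addE (L0_opp x) x))// (near (L0_oppE x))// (near L0_zeroE)//.
by rewrite addNr.
Unshelve. all: by end_near. Qed.

HB.instance Definition _ := GRing.isZmodule.Build (L0 P B)
  L0_addA L0_addC L0_add0 L0_addN.

Definition L0_norm (x : L0 P B) : {mfun_ P, T >-> R} :=
  \pi_{mfun_ P, T >-> R}
    (mfun_Sub (mem_set (measurable_rnorm (sreP (repr x))))).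

Lemma L0_normE x : {ae P, forall t, L0_norm x t = rnorm (x t)}.
Proof. exact: mfun_piE. Qed.

Lemma L0_norm_ge0 x : {ae P, forall t, 0 <= L0_norm x t}.
Proof. by apply: filterS (L0_normE x) => t ->; exact: rnorm_ge0. Qed.

Lemma L0_norm0 : {ae P, forall t, L0_norm 0 t = 0}.
Proof.
by apply: filterS2 (L0_normE 0) L0_zeroE => t -> ->; exact: rnorm0.
Qed.

Lemma L0_normD x y :
  {ae P, forall t, L0_norm (x + y) t <= L0_norm x t + L0_norm y t}.
Proof.
near=> t; rewrite (near (L0_normE (x + y)))// (near (L0_addE x y))//.
rewrite (near (L0_normE x))// (near (L0_normE y))//.
exact: rnormD.
Unshelve. all: by end_near. Qed.

(* The (epsilon,lambda)-topology: [el_nbhs0 eps lambda] are the basic          *)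
(* neighbourhoods of 0, and their translates by x those of x.                  *)
Definition el_nbhs0 (eps lambda : R) : set (L0 P B) :=
  [set z | ((1 - lambda)%:E < P [set t | (L0_norm z t < eps)%R])%E].

Definition el_nbhs (x : L0 P B) : set_system (L0 P B) :=
  filter_from [set p : R * R | 0 < p.1 /\ 0 < p.2 < 1]
    (fun p => [set x + z | z in el_nbhs0 p.1 p.2]).


Lemma measurable_L0_norm (U : set R) x : measurable U ->
  measurable [set t | U (L0_norm x t)].
Proof. by move=> mU; exact: (measurable_funPTI (repr (L0_norm x))). Qed.

Lemma el_nbhs0E eps lambda z :
  el_nbhs0 eps lambda z <-> (P [set t | (eps <= L0_norm z t)%R] < lambda%:E)%E.
Proof.
rewrite /el_nbhs0/=.
have mA : measurable [set t | L0_norm z t < eps].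
  rewrite (_ : mkset _ = [set t | `]-oo, eps[%classic (L0_norm z t)]).
    by apply: measurable_L0_norm; exact: measurable_itv.
  by apply/seteqP; split => t /=; rewrite in_itv.
rewrite (_ : [set t | eps <= _] = ~` [set t | L0_norm z t < eps]); last first.
  by apply/seteqP; split => t /=; rewrite leNgt => /negP.
rewrite probability_setC// -[P _]fineK ?fin_num_measure//.
by rewrite -EFinB !lte_fin ltrBlDr ltrBlDl addrC.
Qed.

Lemma ae_le_probability (A C : set T) : measurable A -> measurable C ->
  {ae P, forall t, A t -> C t} -> (P A <= P C)%E.
Proof.
move=> mA mC [N [mN N0 ACN]]; apply: (@le_trans _ _ (P (C `|` N))).
  apply: le_measure; rewrite ?inE//; first exact: measurableU.
  move=> t At; have [Ct|nCt] := pselect (C t); [by left|right].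
  by apply: ACN => /(_ At).
have := measureU2 P mC mN.
by rewrite [X in (_ <= _ + X)%E -> _]N0 adde0.
Qed.

Lemma measurable_L0_norm_ge eps x : measurable [set t | eps <= L0_norm x t].
Proof.
rewrite (_ : mkset _ = [set t | `[eps, +oo[%classic (L0_norm x t)]).
  by apply: measurable_L0_norm; exact: measurable_itv.
by apply/seteqP; split => t /=; rewrite in_itv/= andbT.
Qed.

Lemma el_nbhs0_0 eps lambda : 0 < eps -> 0 < lambda -> el_nbhs0 eps lambda 0.
Proof.
move=> e0 l0; apply/el_nbhs0E; apply: (@le_lt_trans _ _ (P set0)).
  apply: ae_le_probability => //; first exact: measurable_L0_norm_ge.
  by apply: filterS L0_norm0 => t /= ->; rewrite leNgt e0.
by rewrite measure0 lte_fin.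
Qed.

Lemma el_nbhs0S e1 e2 l1 l2 : e1 <= e2 -> l1 <= l2 ->
  el_nbhs0 e1 l1 `<=` el_nbhs0 e2 l2.
Proof.
move=> e12 l12 z /el_nbhs0E zl; apply/el_nbhs0E.
apply: (le_lt_trans _ (lt_le_trans zl _)); last by rewrite lee_fin.
apply: le_measure; rewrite ?inE; [exact: measurable_L0_norm_ge..|].
by move=> t; exact: le_trans.
Qed.

Lemma el_nbhs0D eps lambda z w : el_nbhs0 (eps / 2) (lambda / 2) z ->
  el_nbhs0 (eps / 2) (lambda / 2) w -> el_nbhs0 eps lambda (z + w).
Proof.
move=> /el_nbhs0E zl /el_nbhs0E wl; apply/el_nbhs0E.
pose A x := [set t | eps / 2 <= L0_norm x t].
apply: (@le_lt_trans _ _ (P (A z `|` A w))).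
  apply: ae_le_probability; first exact: measurable_L0_norm_ge.
    by apply: measurableU; exact: measurable_L0_norm_ge.
  apply: filterS (L0_normD z w) => t ht et; rewrite /A/=.
  have [|zt] := leP (eps / 2) (L0_norm z t); first by left.
  have [|wt] := leP (eps / 2) (L0_norm w t); first by right.
  have := le_lt_trans (le_trans et ht) (ltrD zt wt).
  by rewrite -splitr ltxx.
have := measureU2 P (measurable_L0_norm_ge (eps / 2) z)
  (measurable_L0_norm_ge (eps / 2) w).
move=> /le_lt_trans; apply.
by rewrite [lambda in ltRHS]splitr EFinD lteD.
Qed.

HB.instance Definition _ := hasNbhs.Build (L0 P B) el_nbhs.

Local Lemma el_nbhs_filter (x : L0 P B) : ProperFilter (nbhs x).
Proof.
apply: filter_from_proper; last first.
  move=> [e l] /= [e0 /andP[l0 l1]]; exists (x + 0); exists 0 => //.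
  exact: el_nbhs0_0.
apply: filter_from_filter.
  exists (1, 1 / 2) => /=; split => //.
  by rewrite divr_gt0//= ltr_pdivrMr// mul1r ltr1n.
move=> [e1 l1] [e2 l2] /= [e10 /andP[l10 l11]] [e20 /andP[l20 l21]].
exists (Num.min e1 e2, Num.min l1 l2) => /=.
  by rewrite !lt_min e10 e20 l10 l20 gt_min l11.
move=> _ [z zN <-]; split; exists z => //;
  by apply: el_nbhs0S zN; rewrite ge_min lexx ?orbT.
Qed.

Local Lemma el_nbhs_singleton (x : L0 P B) (A : set (L0 P B)) : nbhs x A -> A x.
Proof.
move=> [[e l] /= [e0 /andP[l0 l1]]]; apply; exists 0; last exact: addr0.
exact: el_nbhs0_0.
Qed.

Local Lemma el_nbhs_nbhs (x : L0 P B) (A : set (L0 P B)) :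
  nbhs x A -> nbhs x (nbhs^~ A).
Proof.
move=> [[e l] /= [e0 /andP[l0 l1]] xA].
have le : 0 < e / 2 /\ 0 < l / 2 < 1.
  by rewrite !divr_gt0//= ltr_pdivrMr// mul1r (lt_trans l1)// ltr1n.
exists (e / 2, l / 2) => //= _ [z zN <-].
exists (e / 2, l / 2) => //= _ [w wN <-].
apply: xA; exists (z + w); last exact: addrA.
exact: el_nbhs0D.
Qed.

HB.instance Definition _ := Nbhs_isNbhsTopological.Build (L0 P B)
  el_nbhs_filter el_nbhs_singleton el_nbhs_nbhs.

Definition L0_convex (G : set (L0 P B)) :=
  forall (x y : L0 P B) (xi eta : {mfun_ P, T >-> R}),
    G x -> G y -> L0R_plus xi -> L0R_plus eta -> L0R_add xi eta = L0R_cst P 1 ->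
    G (L0_scale xi x + L0_scale eta y).

Definition L0bar_norm (x : L0 P B) := L0bar_of (L0_norm x).

Definition random_diam (H : set (L0 P B)) : {mfun_ P, T >-> \bar R} :=
  bigvee [set L0bar_norm (h1 - h2) | h1 in H & h2 in H].

Definition as_bounded (H : set (L0 P B)) :=
  exists2 xi, L0R_plus xi & bigvee [set L0bar_norm h | h in H] = L0bar_of xi.

Definition random_normal_structure (G : set (L0 P B)) :=
  [/\ G !=set0, closed G, L0_convex G &
      forall H : set (L0 P B), H `<=` G -> H !=set0 ->
        closed H -> as_bounded H -> L0_convex H ->
        (L0bar_cst P 0 < random_diam H)%O ->
        exists2 h0, H h0 &
          lt_on [set t | (0 < random_diam H t)%E]
            (bigvee [set L0bar_norm (h0 - h) | h in H]) (random_diam H)].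

(* L^0(F,V): V is coerced to the type of its elements, with the subspace       *)
(* topology, so X and its simple approximants are V-valued.                    *)
Definition L0_in (V : set B) : set (L0 P B) :=
  [set x | exists X : strongRE T V, {ae P, forall t, x t = set_val (X t)}].

End L0_banach.

Arguments L0_in {d T R} P {k B} V.

(* Main.v *)
Require Import Defs.
From mathcomp Require Import all_boot all_order all_algebra.
From mathcomp Require Import all_classical all_reals all_analysis.
From mathcomp Require Import generic_quotient measurable_realfun lra ring.

(* Essential suprema are suprema of countable subfamilies, so every condition *)
(* on H involves only countably many members of H at a time. Among the events *)
(* E_h = (radius of H at h < D(H)), h in H, pick countably many covering all *)
(* the others almost surely; gluing the corresponding h_n along the first E_n *)
(* that occurs gives h0 in H, because H is closed and L^0-convex. It remains *)
(* to see that the E_n cover (D(H) > 0). Close one element of H under rational *)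
(* convex combinations and under choosing sequences that realise the radii. At *)
(* almost every w outside the union of the E_n, the values at w of this *)
(* countable family form a sequence in V all of whose points are diametral, *)
(* with diameter D(H)(w); if D(H)(w) > 0, its closure contradicts the normal *)
(* structure of V. *)

(** The obstacle is that an almost sure statement survives only countable intersections, while
    normal structure of [V] has to be applied at each single point t. The deterministic core is
    therefore a statement about sequences, [normal_structure_no_diametral_seq]: a sequence in [V],
    closed under rational convex combinations, cannot have all its points diametral. [bigvee_seq]
    and [exhaustion] replace [H] by countable subfamilies, and [countable_op_closure] makes one of
    them stable enough for the core to apply to its values at almost every t. This yields
    [normal_structure_radius]: countably many members of [H] suffice to make the radius smaller than
    the diameter, each on its own event. [closed_L0_convex_glue] merges them into one member of
    [H]. *)

Set Implicit Arguments.
Unset Strict Implicit.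
Unset Printing Implicit Defensive.

Import Order.TTheory GRing.Theory Num.Theory.
Import numFieldNormedType.Exports.

Local Open Scope classical_set_scope.
Local Open Scope ring_scope.
Local Open Scope quotient_scope.

(** * Diametral sequences *)

Section scalar_norm.
Context {R : realType} {k : scalars} {B : normedModType (scalar_field R k)}.
Implicit Types (x y : B) (A V : set B).

Lemma rnormB x y : rnorm (x - y) = rnorm (y - x).
Proof. by rewrite -rnormN opprB. Qed.

Lemma rnormB_trans y x z : rnorm (x - z) <= rnorm (x - y) + rnorm (y - z).
Proof. by apply: le_trans (rnormD _ _); rewrite addrA subrK. Qed.

Lemma rnormZ (a : R) x : rnorm (inK k a *: x) = `|a| * rnorm x.
Proof.
have h : inK k (rnorm (inK k a *: x)) = inK k (`|a| * rnorm x).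
  by rewrite inK_rnorm normrZ norm_inK inKM inK_rnorm.
by apply/le_anti; rewrite -!(inK_le (k := k)) h lexx.
Qed.

Lemma nbhs_rnormP x (P : set B) :
  nbhs x P <-> exists2 e : R, 0 < e & forall y, rnorm (x - y) < e -> P y.
Proof.
split=> [/nbhs_normP[e /= e0 eP]|[e e0 eP]].
  have ie : inK k (reK e) = e by rewrite inK_reK// ltW.
  exists (reK e); first by rewrite -(inK_lt (k := k)) inK0 ie.
  move=> y; rewrite -(inK_lt (k := k)) inK_rnorm ie => xy.
  exact: eP.
apply/nbhs_normP; exists (inK k e); first by rewrite /= -(inK0 (k := k)) inK_lt.
by move=> y /= xy; apply: eP; rewrite -(inK_lt (k := k)) inK_rnorm.
Qed.

Lemma closure_rnormP A x :
  closure A x <-> forall e : R, 0 < e -> exists2 y, A y & rnorm (x - y) < e.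
Proof.
split=> [clA e e0|h U /nbhs_rnormP[e e0 eU]].
  have /clA[y [Ay xy]] : nbhs x [set y | rnorm (x - y) < e].
    by apply/nbhs_rnormP; exists e.
  by exists y.
by have [y Ay xy] := h _ e0; exists y; split=> //; exact: eU.
Qed.

Lemma cvg_rnormP (u : B^nat) x :
  u @ \oo --> x <-> (fun n => rnorm (x - u n)) @ \oo --> (0 : R).
Proof.
split=> [ux|/cvgrPdist_lt h].
  have xu : (fun n => x - u n) @ \oo --> x - x.
    by apply: cvgB ux; exact: cvg_cst.
  rewrite -(rnorm0 (B := B)) -(subrr x).
  exact: (cvg_comp _ _ xu (@rnorm_continuous R k B (x - x))).
move=> U /nbhs_rnormP[e e0 eU].
apply: filterS (h e e0) => n /=.
by rewrite sub0r normrN ger0_norm ?rnorm_ge0//; exact: eU.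
Qed.

(** The coefficients of [convex_set] live in the scalar field; one between 0 and 1 is real even over
    the complex numbers, because the order there only compares numbers with equal imaginary
    parts. *)
Lemma convex_setP A : convex_set A <->
  forall (a b : R) x y, 0 <= a -> 0 <= b -> a + b = 1 -> A x -> A y ->
    A (inK k a *: x + inK k b *: y).
Proof.
split=> [cA a b x y a0 b0 ab Ax Ay|cA x y l /set_mem Ax /set_mem Ay].
  have ia0 : 0 <= inK k a by rewrite -(inK0 (k := k)) inK_le.
  have ia1 : inK k a <= 1 by rewrite -(inK1 (k := k)) inK_le -ab lerDl.
  have := cA x y (Itv01 ia0 ia1).
  rewrite !inE => /(_ Ax Ay).
  change (A (inK k a *: x + (1 - inK k a) *: y) ->
          A (inK k a *: x + inK k b *: y)).
  have -> : 1 - inK k a = inK k b by rewrite -inK1 -inKB -ab addrAC subrr add0r.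
  exact.
have l0 : 0 <= l%:num by [].
have l1 : l%:num <= 1 by [].
apply/mem_set; change (A (l%:num *: (x : B) + (1 - l%:num) *: (y : B))).
rewrite -(inK_reK l0) -inK1 -inKB.
apply: cA => //.
- by rewrite -(inK_le (k := k)) inK0 inK_reK.
- by rewrite subr_ge0 -(inK_le (k := k)) inK1 inK_reK.
- by rewrite addrC subrK.
Qed.

(* The closure of the sequence is a diametral closed convex subset of [V]. *)
Lemma normal_structure_no_diametral_seq V (c : nat -> B) (r : R) :
  normal_structure V -> 0 < r -> (forall m, V (c m)) ->
  (forall m n, rnorm (c m - c n) <= r) ->
  (forall m e, e < r -> exists n, e < rnorm (c m - c n)) ->
  (forall (q : rat) m n, 0 <= q <= 1 -> exists j,
    c j = inK k (ratr q) *: c m + inK k (1 - ratr q) *: c n) -> False.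
Proof.
move=> [_ clV _ nsV] r0 Vc cr cd cq.
pose K := closure (range c).
have Kc m : K (c m) by apply: subset_closure; exists m.
have Kr x y : K x -> K y -> rnorm (x - y) <= r.
  move=> /closure_rnormP Kx /closure_rnormP Ky; apply/ler_addgt0Pr => e e0.
  have e20 : 0 < e / 2 by rewrite divr_gt0.
  have [_ [m _ <-] xm] := Kx _ e20.
  have [_ [n _ <-] yn] := Ky _ e20.
  have := rnormB_trans (c m) x y; have := rnormB_trans (c n) (c m) y.
  by have := cr m n; rewrite rnormB in yn; lra.
have diamK : diam K = r.
  apply/le_anti/andP; split.
    apply: ge_sup.
      by exists (rnorm (c 0 - c 0)), (c 0) => //; exists (c 0).
    by move=> _ [x Kx [y Ky <-]]; exact: Kr.
  rewrite leNgt; apply/negP => /(cd 0)[n]; apply/negP; rewrite -leNgt.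
  apply: ub_le_sup; last by exists (c 0) => //; exists (c n).
  by exists r => _ [x Kx [y Ky <-]]; exact: Kr.
have KV : K `<=` V.
  rewrite [V in _ `<=` V](closure_id V).1//; apply: closure_subset.
  by move=> _ [m _ <-].
have bK : bounded_set K.
  have PF : ProperFilter (globally K).
    by apply: globally_properfilter; exact: Kc 0.
  apply/ex_bound; exists (inK k (r + rnorm (c 0))) => x Kx /=.
  rewrite -inK_rnorm inK_le -[x in leLHS](subrK (c 0)).
  by apply: le_trans (rnormD _ _) _; rewrite lerD2r; exact: Kr.
have cK : convex_set K.
  apply/convex_setP => a b x y a0 b0 ab Kx Ky.
  apply/closure_rnormP => e e0.
  have e20 : 0 < e / 2 by rewrite divr_gt0.
  have [_ [m _ <-] xm] := (closure_rnormP _ _).1 Kx _ e20.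
  have [_ [n _ <-] yn] := (closure_rnormP _ _).1 Ky _ e20.
  (* Moving the coefficient by less than [d] moves a combination of [c m] and [c n] by less than
     [d * r = e / 2], as these points are at distance at most [r]. *)
  pose d := e / 2 / r.
  have d0 : 0 < d by rewrite divr_gt0.
  have a1 : a <= 1 by rewrite -ab lerDl.
  have [q] : exists q : rat, ratr q \in `]Num.max 0 (a - d), Num.min 1 (a + d)[.
    apply: rat_in_itvoo; rewrite gt_max !lt_min ltr01/=.
    by apply/and3P; split; lra.
  rewrite in_itv/= gt_max lt_min => /andP[/andP[q0 qa] /andP[q1 aq]].
  have [|j cj] := cq q m n.
    by apply/andP; split; rewrite -(ler_rat R) ?rmorph0 ?rmorph1 ltW.
  exists (c j); first by exists j.
  apply: le_lt_trans (rnormB_trans (inK k a *: c m + inK k b *: c n) _ _) _.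
  have -> : inK k a *: x + inK k b *: y - (inK k a *: c m + inK k b *: c n) =
      inK k a *: (x - c m) + inK k b *: (y - c n).
    by rewrite !scalerBr opprD addrACA.
  have -> : inK k a *: c m + inK k b *: c n - c j =
      inK k (a - ratr q) *: (c m - c n).
    rewrite cj opprD addrACA -!scalerBl -!inKB scalerBr -scaleNr.
    have -> : b - (1 - ratr q) = 0 - (a - ratr q) by rewrite -ab; ring.
    by rewrite [inK k (0 - _)]inKB inK0 sub0r.
  rewrite [ltRHS]splitr ler_ltD//.
    apply: le_trans (rnormD _ _) _; rewrite !rnormZ !ger0_norm//.
    apply: (@le_trans _ _ (a * (e / 2) + b * (e / 2))).
      by rewrite lerD// ler_wpM2l// ltW.
    by rewrite -mulrDl ab mul1r.
  rewrite rnormZ; apply: (@le_lt_trans _ _ (`|a - ratr q| * r)).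
    by rewrite ler_wpM2l.
  by rewrite -ltr_pdivlMr// ltr_norml -/d; apply/andP; split; lra.
have [] := nsV K KV bK (@closed_closure _ _) cK; first by rewrite diamK.
move=> h Kh; rewrite diamK => hr.
set s := sup _ in hr.
(* A point [c m] within [(r - s) / 2] of [h] has all its distances to the sequence at most
   [(r - s) / 2 + s = (r + s) / 2 < r], so it is not diametral. *)
have e0 : 0 < (r - s) / 2 by rewrite divr_gt0// subr_gt0.
have [_ [m _ <-] hm] := (closure_rnormP _ _).1 Kh _ e0.
have [|n] := cd m ((r + s) / 2).
  by rewrite ltr_pdivrMr// mulr_natr mulr2n ltrD2l.
apply/negP; rewrite -leNgt.
apply: le_trans (rnormB_trans h _ _) _.
have : rnorm (h - c n) <= s.
  apply: ub_le_sup; last by exists (c n).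
  by exists r => _ [x Kx <-]; exact: Kr.
rewrite rnormB in hm; lra.
Qed.
End scalar_norm.

(** * Exhaustion and essential suprema *)

(** The terms built from [s0] with the operations [g i] are finite trees labelled by codes of [I],
    hence countable; [c n] evaluates the tree coded by [n]. Leaves and ill-formed trees evaluate to
    [s0]. *)
Lemma countable_op_closure (I : countType) (S : Type) (s0 : S)
    (g : I -> S -> S -> S) :
  exists c : nat -> S, forall i m n, exists j, c j = g i (c m) (c n).
Proof.
pose ev := fix ev (t : GenTree.tree unit) : S :=
  if t is GenTree.Node i [:: t1; t2] then
    if unpickle i is Some i' then g i' (ev t1) (ev t2) else s0
  else s0.
pose tree_of n : GenTree.tree unit := odflt (GenTree.Leaf tt) (unpickle n).
exists (ev \o tree_of) => i m n.
exists (pickle (GenTree.Node (pickle i) [:: tree_of m; tree_of n])).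
by rewrite /= /tree_of pickleK /= pickleK.
Qed.

Section exhaustion.
Context d (T : measurableType d) (R : realType) (P : probability T R).

Lemma ae_forall_countable (I : countType) (Q : I -> T -> Prop) :
  (forall i, {ae P, forall t, Q i t}) -> {ae P, forall t i, Q i t}.
Proof.
move=> aeQ.
have : {ae P, forall t (n : nat) i, unpickle n = Some i -> Q i t}.
  apply: ae_foralln => n; case: unpickle => [i|]; last exact: aeW.
  by apply: filterS (aeQ i) => t Qt _ [<-].
by apply: filterS => t Qt i; exact/Qt/pickleK.
Qed.

Lemma exhaustion (I : Type) (i0 : I) (E : I -> set T) :
  (forall i, measurable (E i)) ->
  exists u : nat -> I, forall i,
    {ae P, forall t, E i t -> exists n, E (u n) t}.
Proof.
move=> mE.
pose U (u : nat -> I) := \bigcup_n E (u n).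
have mU u : measurable (U u) by exact: bigcupT_measurable.
pose F := [set fine (P (U u)) | u in [set: nat -> I]].
have PU u : P (U u) = (fine (P (U u)))%:E by rewrite fineK ?fin_num_measure.
have F1 : has_ubound F.
  exists 1 => _ [u _ <-]; rewrite -lee_fin -PU; exact: probability_le1.
have F0 : F !=set0 by exists (fine (P (U (fun=> i0)))), (fun=> i0).
have /choice[w wP] m : exists u : nat -> I, sup F - m.+1%:R^-1 < fine (P (U u)).
  have m0 : 0 < m.+1%:R^-1 :> R by rewrite invr_gt0.
  have [_ [u _ <-] su] := sup_adherent m0 (conj F0 F1).
  by exists u.
pose v n : I :=
  if @unpickle (nat * nat)%type n is Some p then w p.1 p.2 else i0.
have wv m : U (w m) `<=` U v.
  by move=> t [n _ Et]; exists (pickle (m, n)) => //; rewrite /v pickleK.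
have vsup : sup F <= fine (P (U v)).
  apply/ler_addgt0Pr => e e0.
  have [m me] := ltr_add_invr e0.
  have h : fine (P (U (w m))) <= fine (P (U v)).
    by rewrite -lee_fin -(PU (w m)) -(PU v) le_measure ?inE.
  rewrite add0r in me; rewrite -lerBlDr; apply: le_trans h.
  by apply/ltW/(le_lt_trans _ (wP m)); rewrite lerD2l lerN2 ltW.
exists v => i.
pose v' n := if n is n'.+1 then v n' else i.
have UE : U v' = U v `|` E i `\` U v.
  rewrite setDE setUIr setUv setIT; apply/seteqP; split => t.
    by move=> [[|n] _ Et]; [right|left; exists n].
  by move=> [[n _ Et]|Et]; [exists n.+1|exists 0].
have vle : fine (P (U v')) <= sup F by apply: ub_le_sup => //; exists v'.
exists (E i `\` U v); split.
- exact: measurableD.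
- have : P (U v') = (P (U v) + P (E i `\` U v))%E.
    rewrite UE measureU//; first exact: measurableD.
    by rewrite setDE setICA setICr setI0.
  rewrite (PU v') (PU v).
  rewrite -(fineK (fin_num_measure P _ (measurableD (mE i) (mU v)))).
  move=> [PUE]; congr EFin; apply/le_anti/andP; split; last exact: fine_ge0.
  by rewrite PUE in vle; lra.
- move=> t /= /not_implyP[Et nU]; split=> //.
  by move=> [n _ Un]; apply: nU; exists n.
Qed.
End exhaustion.

Lemma ereal_rat_between (R : realType) (a b : \bar R) :
  (a < b)%E -> exists q : rat, (a < (ratr q)%:E < b)%E.
Proof.
have itv (x y : R) : x < y -> exists q : rat, x < ratr q < y.
  by move=> /rat_in_itvoo[q]; rewrite in_itv/=; exists q.
case: a b => [a| |] [b| |]//.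
- by rewrite lte_fin => /itv[q]; rewrite -!lte_fin; exists q.
- have [|q /andP[aq _]] := itv a (a + 1); first by rewrite ltrDl.
  by exists q; rewrite lte_fin aq ltry.
- have [|q /andP[_ qb]] := itv (b - 1) b; first by rewrite ltrBlDr ltrDl.
  by exists q; rewrite lte_fin qb ltNyr.
- by exists 0; rewrite ltNyr ltry.
Qed.

Section essential_supremum.
Context d (T : measurableType d) (R : realType) (P : probability T R).
Local Notation L0bar := {mfun_ P, T >-> \bar R}.

Lemma measurable_L0bar (f : L0bar) : measurable_fun setT f.
Proof. exact: (measurable_funPT (repr f)). Qed.

Lemma L0bar_leP (f g : L0bar) : (f <= g)%O <-> {ae P, forall t, (f t <= g t)%E}.
Proof. by split=> [/asboolP//|?]; exact/asboolP. Qed.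

(** For each rational q, countably many events (g > q) cover all the others almost surely. Let h be
    the pointwise supremum of the members of [S] so selected. If g > h somewhere, a rational q
    strictly between them would, off a null set, produce a selected member above q, a contradiction.
    So h is an upper bound, and being a countable supremum it is the least. *)
Lemma bigvee_seq (S : set L0bar) : S !=set0 ->
  exists f : nat -> L0bar, [/\ forall n, S (f n),
    {ae P, forall t, bigvee S t = ereal_sup (range (f^~ t))} &
    forall g, S g -> {ae P, forall t, (g t <= bigvee S t)%E}].
Proof.
move=> [g0 Sg0].
pose I := {g | S g}.
have /choice[u uP] (q : rat) : exists u : nat -> I, forall g : I,
    {ae P, forall t, ((ratr q)%:E < sval g t)%E ->
      exists n, ((ratr q)%:E < sval (u n) t)%E}.
  apply: (@exhaustion _ _ _ P I (exist _ g0 Sg0)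
    (fun g => [set t | ((ratr q)%:E < sval g t)%E])) => g.
  rewrite -[X in measurable X]setTI.
  exact/emeasurable_fun_o_infty/measurable_L0bar.
pose f n : L0bar :=
  if @unpickle (rat * nat)%type n is Some p then sval (u p.1 p.2) else g0.
have Sf n : S (f n) by rewrite /f; case: unpickle => // p; exact: svalP.
have mh : measurable_fun setT (fun t => ereal_sup (range (f^~ t))).
  rewrite (_ : (fun t => _) = fun t => esups (f^~ t) 0).
    by apply: measurable_fun_esups => n; exact: measurable_L0bar.
  apply/funext => t; congr ereal_sup; apply/seteqP; split=> _ [n _ <-].
    by exists n.
  by exists n.
pose h : L0bar := \pi_L0bar (mfun_Sub (mem_set mh)).
have hE : {ae P, forall t, h t = ereal_sup (range (f^~ t))} by exact: mfun_piE.
have ubh g : S g -> {ae P, forall t, (g t <= h t)%E}.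
  move=> Sg.
  have : {ae P, forall t (q : rat), ((ratr q)%:E < g t)%E ->
      exists n, ((ratr q)%:E < sval (u q n) t)%E}.
    by apply: ae_forall_countable => q; exact: (uP q (exist _ g Sg)).
  apply: filterS2 hE => t ht gt; rewrite leNgt; apply/negP.
  move=> /ereal_rat_between[q /andP[hq qg]].
  have [n qn] := gt q qg.
  move: hq; rewrite ht; apply/negP; rewrite -leNgt.
  apply: le_trans (ltW qn) _; apply: ereal_sup_ubound.
  by exists (pickle (q, n)) => //; rewrite /f pickleK.
have suph : supremums S h.
  split=> [g /ubh/L0bar_leP//|g' ubg].
  pose g : L0bar := g'; change (h <= g)%O; apply/L0bar_leP.
  have : {ae P, forall t n, (f n t <= g t)%E}.
    by apply: ae_foralln => n; apply/L0bar_leP; exact: ubg.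
  apply: filterS2 hE => t -> fg; apply: ge_ereal_sup => _ [n _ <-].
  exact: fg.
have -> : bigvee S = h.
  rewrite /bigvee /supremum ifF; last by apply/negbTE/set0P; exists g0.
  by case: xgetP => [x _ Sx|/(_ h)//]; exact: is_subset1_supremums Sx suph.
by exists f.
Qed.
End essential_supremum.

(** * Gluing random elements *)

Section gluing.
Context d (T : measurableType d).

Lemma measurable_nat_fun (N : T -> nat) :
  (forall n, measurable (N @^-1` [set n])) -> measurable_fun setT N.
Proof.
move=> mN _ Y _; rewrite setTI.
rewrite (_ : _ @^-1` _ = \bigcup_(n in Y) N @^-1` [set n]).
  exact: bigcup_measurable.
by apply/seteqP; split=> [t Yt|t [n Yn /= Nt]]; [exists (N t)|rewrite /= Nt].
Qed.

(** The bound [m] keeps the range inside a finite union of finite ranges. *)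
Lemma simple_glue (M : topologicalType) (N : T -> nat) (m : nat)
    (s : nat -> T -> M) :
  measurable_fun setT N -> (forall t, (N t <= m)%N) ->
  (forall n, simple_random_element (s n)) ->
  simple_random_element (fun t => s (N t) t).
Proof.
move=> mN Nm ss; split.
  move=> G oG.
  rewrite (_ : _ @^-1` _ = \bigcup_n (N @^-1` [set n] `&` s n @^-1` G)).
    apply: bigcupT_measurable => n; apply: measurableI; last exact: (ss n).1.
    by rewrite -[X in measurable X]setTI; exact: mN.
  by apply/seteqP; split=> [t Gt|t [n _ [/= -> //]]]; exists (N t).
apply: (@sub_finite_set _ _ (\bigcup_(n in `I_m.+1) range (s n))).
  by move=> _ [t _ <-]; exists (N t); [rewrite /= ltnS|exists t].
by apply: bigcup_finite => // n _; exact: (ss n).2.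
Qed.

(** Truncating the index at [m] makes the [m]-th approximant simple, and at each point the
    truncation is inactive as soon as [m] reaches [N t]. *)
Lemma strong_glue (M : topologicalType) (N : T -> nat) (X : nat -> T -> M) :
  measurable_fun setT N -> (forall n, strong_random_element (X n)) ->
  strong_random_element (fun t => X (N t) t).
Proof.
move=> mN sX.
have /choice[s sP] n : exists s : (T -> M)^nat,
    (forall m, simple_random_element (s m)) /\ forall t, s ^~ t @ \oo --> X n t.
  by have [s] := sX n; exists s.
exists (fun m t => s (minn (N t) m) m t) => [m|t].
  apply: (@simple_glue _ (fun t => minn (N t) m) m (fun n => s n m)).
  - by apply: (measurableT_comp (f := fun n => minn n m)).
  - by move=> t; exact: geq_minr.
  - by move=> n; exact: (sP n).1.
apply: cvg_trans ((sP (N t)).2 t); apply: near_eq_cvg.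
by exists (N t) => // m /= Nm; rewrite (minn_idPl Nm).
Qed.

Lemma measurable_hitting_index (E : nat -> set T) :
  (forall n, measurable (E n)) ->
  exists2 N : T -> nat, measurable_fun setT N & forall t n, E n t -> E (N t) t.
Proof.
move=> mE; pose N t := xget 0%N [set n | seqDU E n t].
(* [N t] is the first index that hits [t]. Points hit by no event get the default 0, so the fibre of
   0 is not [seqDU E 0] in general; it is measurable as the complement of the others. *)
have NS n : N @^-1` [set n.+1] = seqDU E n.+1.
  apply/seteqP; split=> t; rewrite /N /preimage /=.
    by case: xgetP => [m -> + mn|//]; rewrite /= mn.
  move=> Et; case: xgetP => [m _ Em|/(_ n.+1)//].
  by apply: (@trivIset_seqDU _ E m n.+1 I I); exists t.
have mNS n : measurable (N @^-1` [set n.+1]).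
  by rewrite NS; exact: seqDU_measurable.
exists N.
  apply: measurable_nat_fun => -[|n]; last exact: mNS.
  rewrite (_ : _ @^-1` _ = ~` \bigcup_n N @^-1` [set n.+1]).
    by apply: measurableC; exact: bigcupT_measurable.
  apply/seteqP; split=> t /=.
    by move=> N0 [n _ /=]; rewrite N0.
  by case NE: (N t) => [//|n] nU; exfalso; apply: nU; exists n.
move=> t n Et; have : (\bigcup_n seqDU E n) t.
  by rewrite -seqDU_bigcup_eq; exists n.
move=> [m _ Em]; rewrite /N; case: xgetP => [j _ Ej|/(_ m)//].
exact: subset_seqDU Ej.
Qed.

End gluing.

(** * The set of V-valued classes: closedness and convexity *)

Section L0_in.
Context d (T : measurableType d) (R : realType) (P : probability T R).
Context {k : scalars} (B : normedModType (scalar_field R k)).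
Implicit Types (V : set B) (x : L0 P B).

Lemma strong_subtype V (X : T -> B) (X' : T -> V) : strong_random_element X ->
  (forall t, X t = set_val (X' t)) -> strong_random_element X'.
Proof.
move=> [s ss sX] XX'.
(* [q (n, _)] nearly minimises the distance to [V], so that [q (n, s n t)] is *)
(* at distance at most [2 |X t - s n t| + 1/(n+1)] from [X t]. *)
have /choice[q qP] (p : nat * B) : exists v : V, forall w : V,
    rnorm (set_val v - p.2) <= rnorm (set_val w - p.2) + p.1.+1%:R^-1.
  pose F := [set rnorm (set_val w - p.2) | w in [set: V]].
  have F0 : has_inf F.
    split; first by exists (rnorm (set_val (X' point) - p.2)), (X' point).
    by exists 0 => _ [w _ <-]; exact: rnorm_ge0.
  have p0 : (0 : R) < p.1.+1%:R^-1 by rewrite invr_gt0.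
  have [_ [v _ <-] vF] := inf_adherent p0 F0.
  exists v => w; apply: le_trans (ltW vF) _; rewrite lerD2r.
  by apply: ge_inf; [exact: F0.2|exists w].
exists (fun n t => q (n, s n t)) => [n|t].
  (* [q] comes from choice and need not be continuous or measurable; composing it with a simple
     random element is still simple. The second argument is a dummy. *)
  apply: (@simple_comp2 _ _ _ _ _ (fun x _ : B => q (n, x)));
    by [exact: normed_accessible|exact: ss].
have qX : (fun n => set_val (q (n, s n t))) @ \oo --> X t.
  apply/cvg_rnormP.
  apply: (@squeeze_cvgr _ _ _ _ (cst 0)
    (fun n => rnorm (X t - s n t) *+ 2 + n.+1%:R^-1)).
  - apply: nearW => n; rewrite rnorm_ge0/=.
    have := qP (n, s n t) (X' t); rewrite /= -XX' rnormB => h.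
    apply: le_trans (rnormB_trans (s n t) _ _) _.
    by rewrite mulr2n -addrA lerD2l.
  - exact: cvg_cst.
  - rewrite -[X in _ --> X]addr0; apply: cvgD; last exact: cvg_harmonic.
    rewrite -(mul0rn _ 2); apply: cvgMn; exact/cvg_rnormP.
move=> U [_ [[W oW <-] /= WX sWU]].
have : nbhs (X t) W by rewrite XX'; exact: open_nbhs_nbhs.
by move=> /qX; apply: (@filterS _ \oo) => n /= ?; exact: sWU.
Qed.

(** Overwriting [x] by a fixed point of [V] on a null set makes it V-valued everywhere;
    [strong_subtype] then supplies approximants with values in [V]. *)
Lemma L0_inP V x : V !=set0 -> L0_in P V x <-> {ae P, forall t, V (x t)}.
Proof.
move=> [v Vv]; split=> [[X]|[A [mA PA VA]]].
  by apply: filterS => t ->; exact/set_mem/valP.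
pose X t := if t \in A then v else x t.
have VX t : V (X t).
  rewrite /X; case: ifPn => //; apply: contraNP => nVx.
  by apply/mem_set/VA.
pose X' t : V := exist _ (X t) (mem_set (VX t)).
have sX : strong_random_element X.
  pose F n : T -> B := if n is 0 then x else cst v.
  have -> : X = fun t => F (t \in A : nat) t.
    by apply/funext => t; rewrite /X; case: (t \in A).
  apply: strong_glue => [|[|n]]; last 2 first.
  - exact: sreP (repr x).
  - exact: strong_cst.
  apply: (@measurableT_comp _ _ _ _ _ _ nat_of_bool) => //.
  apply: (measurable_fun_bool true); rewrite setTI.
  rewrite (_ : _ @^-1` _ = A)//; apply/seteqP; split=> t; first exact: set_mem.
  exact: mem_set.
exists (StrongRE (@strong_subtype V X X' sX (fun=> erefl))).
exists A; split => // t /=; apply: contra_notP => nA.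
by rewrite set_valE /= /X memNset.
Qed.

(** For fixed [e], perturbations [y m] with [x + y m] in the set and probability of [‖y m‖ >= e]
    tending to 0 show that almost every [x t] is within [e] of [V]. Taking [e = 1/(n+1)] for all n
    puts [x t] in the closure of [V]. *)
Lemma closed_L0_in V : V !=set0 -> closed V -> closed (L0_in P V).
Proof.
move=> V0 clV.
suff clL (x : L0 P B) : closure (L0_in P V) x -> L0_in P V x by exact: clL.
move=> clx; apply/(L0_inP _ V0).
suff : {ae P, forall t n, exists2 v, V v & rnorm (x t - v) < n.+1%:R^-1}.
  apply: filterS => t xV; apply: clV; apply/closure_rnormP => e e0.
  have [n] := ltr_add_invr e0; rewrite add0r => ne.
  by have [v Vv xv] := xV n; exists v => //; exact: lt_trans ne.
apply: ae_foralln => n; set e : R := n.+1%:R^-1.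
have e0 : 0 < e by rewrite invr_gt0.
(* The shift by 2 keeps the parameter strictly below 1, as a basic neighbourhood requires. *)
have l0 m : 0 < (m.+2%:R^-1 : R) < 1.
  by apply/andP; split; [rewrite invr_gt0|rewrite invf_lt1 ?ltr1n].
have /choice[y yP] m : exists z : L0 P B,
    L0_in P V (x + z) /\ el_nbhs0 e m.+2%:R^-1 z.
  have /clx[w [Vw [z zN zw]]] : nbhs x [set x + z | z in el_nbhs0 e m.+2%:R^-1].
    by exists (e, m.+2%:R^-1) => //; split=> //; exact: l0.
  by exists z; rewrite zw.
pose A m := [set t | e <= L0_norm (y m) t].
have mA m : measurable (A m) by exact: measurable_L0_norm_ge.
have PA : P (\bigcap_m A m) = 0%E.
  apply/le_anti/andP; split => //.
  apply/lee_addgt0Pr => l l0'; rewrite add0e.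
  have [m] := ltr_add_invr l0'; rewrite add0r => ml.
  have [_ /el_nbhs0E yl] := yP m.
  apply: (@le_trans _ _ (P (A m))).
    apply: le_measure; rewrite ?inE//; first exact: bigcapT_measurable.
    exact: bigcap_inf.
  apply: (le_trans (ltW yl)); rewrite lee_fin; apply: le_trans (ltW ml).
  by rewrite lef_pV2 ?posrE// ler_nat.
have : {ae P, forall t, ~ (\bigcap_m A m) t}.
  exists (\bigcap_m A m); split=> //; first exact: bigcapT_measurable.
  by move=> t /= /contrapT.
have : {ae P, forall t m, [/\ V (L0_add x (y m) t),
    L0_norm (y m) t = rnorm (y m t) & L0_add x (y m) t = x t + y m t]}.
  apply: ae_foralln => m.
  have [/(L0_inP _ V0) Vy _] := yP m.
  near=> t; split; first by near: t.
    by rewrite (near (L0_normE (y m)) t).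
  by rewrite (near (L0_addE x (y m)) t).
apply: filterS2 => t h /existsNP[m /not_implyP[_ /negP]].
rewrite -ltNge; have [Vxy -> xy] := h m => ye.
by exists (L0_add x (y m) t) => //; rewrite xy opprD addrA subrr sub0r rnormN.
Unshelve. all: by end_near.
Qed.

Lemma L0_convex_L0_in V : V !=set0 -> convex_set V -> L0_convex (L0_in P V).
Proof.
move=> V0 /convex_setP cV x y xi eta /(L0_inP _ V0) Vx /(L0_inP _ V0) Vy.
move=> xi0 eta0 xi_eta; apply/(L0_inP _ V0).
have sum1 : {ae P, forall t, xi t + eta t = 1}.
  have : {ae P, forall t, L0R_cst P 1 t = 1} by exact: mfun_piE.
  by rewrite -xi_eta; apply: filterS2 (L0R_addE xi eta) => t ->.
near=> t.
rewrite (near (L0_addE (L0_scale xi x) (L0_scale eta y)) t)//.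
rewrite (near (L0_scaleE xi x) t)// (near (L0_scaleE eta y) t)//.
by apply: cV; near: t.
Unshelve. all: by end_near.
Qed.
End L0_in.

(** * Gluing inside closed L^0-convex sets *)

Section concatenation.
Context d (T : measurableType d) (R : realType) (P : probability T R).
Context {k : scalars} (B : normedModType (scalar_field R k)).
Variable H : set (L0 P B).
Hypothesis H_convex : L0_convex H.

(** The indicators of [A] and of its complement are admissible coefficients of an L^0-convex
    combination. *)
Lemma L0_convex_glue2 (A : set T) (x y : L0 P B) : measurable A -> H x -> H y ->
  exists2 z : L0 P B, H z &
    {ae P, forall t, (A t -> z t = x t) /\ (~ A t -> z t = y t)}.
Proof.
move=> mA Hx Hy.
pose xi : {mfun_ P, T >-> R} := \pi_{mfun_ P, T >-> R} (indic_mfun A mA).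
pose eta : {mfun_ P, T >-> R} :=
  \pi_{mfun_ P, T >-> R} (indic_mfun (~` A) (measurableC mA)).
have xiE : {ae P, forall t, xi t = \1_A t} by exact: mfun_piE.
have etaE : {ae P, forall t, eta t = \1_(~` A) t} by exact: mfun_piE.
exists (L0_add (L0_scale xi x) (L0_scale eta y)).
  apply: H_convex => //.
  - by apply: filterS xiE => t ->; rewrite indicE ler0n.
  - by apply: filterS etaE => t ->; rewrite indicE ler0n.
  - apply/mfun_eqP.
    have oneE : {ae P, forall t, L0R_cst P 1 t = 1} by exact: mfun_piE.
    near=> t; rewrite (near (L0R_addE xi eta) t)// (near oneE t)//.
    rewrite (near xiE t)// (near etaE t)// !indicE in_setC.
    by case: (t \in A); rewrite ?addr0 ?add0r.
near=> t.
rewrite (near (L0_addE (L0_scale xi x) (L0_scale eta y)) t)//.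
rewrite (near (L0_scaleE xi x) t)// (near (L0_scaleE eta y) t)//.
rewrite (near xiE t)// (near etaE t)// !indicE in_setC; split => At.
  by rewrite mem_set//= inK1 inK0 scale1r scale0r addr0.
by rewrite memNset//= inK1 inK0 scale1r scale0r add0r.
Unshelve. all: by end_near.
Qed.

(** Gluing along the truncated index [minn (N t) m] takes finitely many two-piece gluings and stays
    in [H]. The result differs from [z] only where [m < N t], up to a null set, and the probability
    of that event tends to 0; closedness does the rest. *)
Lemma closed_L0_convex_glue (N : T -> nat) (x : nat -> L0 P B) : closed H ->
  measurable_fun setT N -> (forall n, H (x n)) ->
  exists2 z : L0 P B, H z & {ae P, forall t, z t = x (N t) t}.
Proof.
move=> clH mN Hx.
pose z : L0 P B :=
  \pi_(L0 P B) (StrongRE (strong_glue mN (fun n => sreP (repr (x n))))).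
have zE : {ae P, forall t, z t = x (N t) t} by exact: L0_piE.
exists z => //; apply: clH => U [[e l] /= [e0 /andP[l0 _]] zU].
have g m : exists2 g : L0 P B, H g & {ae P, forall t, g t = x (minn (N t) m) t}.
  elim: m => [|m [g Hg gE]].
    by exists (x 0) => //; apply: aeW => t; rewrite minn0.
  have mA : measurable [set t | (N t <= m)%N].
    by rewrite -[X in measurable X]setTI; exact: (mN _ [set n | (n <= m)%N]).
  have [g' Hg' g'E] := L0_convex_glue2 mA Hg (Hx m.+1).
  exists g' => //; apply: filterS2 gE g'E => t gt [g't1 g't2].
  have [Nm|mN'] := leqP (N t) m.
    by rewrite g't1// gt (minn_idPl Nm) (minn_idPl (leqW Nm)).
  by rewrite g't2 ?(minn_idPr mN')//= leqNgt mN'.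
pose A m := [set t | (m < N t)%N].
have mA m : measurable (A m).
  by rewrite -[X in measurable X]setTI; exact: (mN _ [set n | (m < n)%N]).
have [m PAm] : exists m, (P (A m) < l%:E)%E.
  have : P (A n) @[n --> \oo] --> P (\bigcap_n A n).
    apply: nonincreasing_cvg_mu => //.
    - by rewrite ltey_eq fin_num_measure.
    - exact: bigcapT_measurable.
    - by move=> m n mn; apply/subsetPset => t; exact: leq_ltn_trans.
  rewrite (_ : \bigcap_n A n = set0); last first.
    by apply/seteqP; split=> // t /(_ (N t) I); rewrite /A/= ltnn.
  rewrite measure0 => PA; apply: contrapT => /forallNP PAl.
  have : (l%:E <= 0)%E.
    by apply: (cvge_to_ge PA); apply: nearW => n; rewrite leNgt; apply/negP.
  by rewrite lee_fin leNgt l0.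
have [y Hy yE] := g m.
exists y; split=> //; apply: zU; exists (y - z); last by rewrite addrC subrK.
apply/el_nbhs0E; apply: le_lt_trans PAm; apply: ae_le_probability => //.
  exact: measurable_L0_norm_ge.
near=> t => /=; rewrite (near (L0_normE (y - z)) t)//.
rewrite (near (L0_addE y (- z)) t)// (near (L0_oppE z) t)//.
rewrite (near yE t)// (near zE t)//.
have [_|//] := leqP (N t) m.
by rewrite subrr rnorm0 leNgt e0.
Unshelve. all: by end_near.
Qed.
End concatenation.

(** * Random radius and diameter *)

Section random_radius.
Context d (T : measurableType d) (R : realType) (P : probability T R).
Context {k : scalars} (B : normedModType (scalar_field R k)).
Implicit Types (H : set (L0 P B)) (x y h : L0 P B).

Definition random_radius H x := bigvee [set L0bar_norm (x - h) | h in H].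

Lemma L0bar_normE x : {ae P, forall t, L0bar_norm x t = (rnorm (x t))%:E}.
Proof. by apply: filterS2 (L0_normE x) (L0bar_ofE (L0_norm x)) => t <-. Qed.

Lemma L0bar_normBE x y :
  {ae P, forall t, L0bar_norm (x - y) t = (rnorm (x t - y t))%:E}.
Proof.
near=> t; rewrite (near (L0bar_normE (x - y)) t)//.
by rewrite (near (L0_addE x (- y)) t)// (near (L0_oppE y) t).
Unshelve. all: by end_near. Qed.

Lemma random_radius_seq H x : H !=set0 ->
  exists w : nat -> L0 P B, [/\ forall n, H (w n),
    {ae P, forall t, random_radius H x t =
      ereal_sup (range (fun n => (rnorm (x t - w n t))%:E))} &
    forall h, H h ->
      {ae P, forall t, ((rnorm (x t - h t))%:E <= random_radius H x t)%E}].
Proof.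
move=> [h0 Hh0].
have [|f [fH fE fub]] := @bigvee_seq _ _ _ P [set L0bar_norm (x - h) | h in H].
  by exists (L0bar_norm (x - h0)), h0.
have /choice[w wP] n : exists h, H h /\ L0bar_norm (x - h) = f n.
  by have [h Hh hf] := fH n; exists h.
exists w; split=> [n||h Hh]; first exact: (wP n).1.
  have : {ae P, forall t n, f n t = (rnorm (x t - w n t))%:E}.
    by apply: ae_foralln => n; rewrite -(wP n).2; exact: L0bar_normBE.
  apply: filterS2 fE => t -> ft; congr ereal_sup.
  by under eq_fun do rewrite ft.
have : {ae P, forall t, (L0bar_norm (x - h)%R t <= random_radius H x t)%E}.
  by apply: fub; exists h.
by apply: filterS2 (L0bar_normBE x h) => t ->.
Qed.

Lemma random_diam_ub H x y : H x -> H y ->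
  {ae P, forall t, ((rnorm (x t - y t))%:E <= random_diam H t)%E}.
Proof.
move=> Hx Hy.
pose S := [set L0bar_norm (h1 - h2) | h1 in H & h2 in H].
have Sxy : S (L0bar_norm (x - y)) by exists x => //; exists y.
have [f [_ _ fub]] := bigvee_seq (ex_intro _ _ Sxy).
by apply: filterS2 (L0bar_normBE x y) (fub _ Sxy) => t ->.
Qed.

(** Every difference of members of [H] has norm at most [xi + xi] almost surely, and the random
    diameter is a pointwise supremum of countably many such norms. *)
Lemma random_diam_lty H : H !=set0 -> as_bounded H ->
  {ae P, forall t, (random_diam H t < +oo)%E}.
Proof.
move=> [h0 Hh0] [xi _ xiE].
have bH x : H x -> {ae P, forall t, rnorm (x t) <= xi t}.
  move=> Hx.
  pose S := [set L0bar_norm h | h in H].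
  have Sx : S (L0bar_norm x) by exists x.
  have [f [_ _ fub]] := bigvee_seq (ex_intro _ _ Sx).
  have := fub _ Sx; rewrite xiE.
  apply: filterS3 (L0bar_normE x) (L0bar_ofE xi) => t -> ->.
  by rewrite lee_fin.
pose S := [set L0bar_norm (h1 - h2) | h1 in H & h2 in H].
have S0 : S (L0bar_norm (h0 - h0)) by exists h0 => //; exists h0.
have [f [fS fE _]] := bigvee_seq (ex_intro _ _ S0).
have : {ae P, forall t n, (f n t <= (xi t + xi t)%:E)%E}.
  apply: ae_foralln => n; have [x Hx [y Hy <-]] := fS n.
  apply: filterS3 (L0bar_normBE x y) (bH x Hx) (bH y Hy) => t -> xt yt.
  rewrite lee_fin; apply: le_trans (rnormD _ _) _.
  by rewrite rnormN lerD.
apply: filterS2 fE => t; rewrite -/(random_diam H) => -> ft.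
apply: (@le_lt_trans _ _ (xi t + xi t)%:E); last exact: ltry.
by apply: ge_ereal_sup => _ [n _ <-].
Qed.

Lemma L0_convex_rat H (q : rat) x y : L0_convex H -> 0 <= q <= 1 ->
  H x -> H y -> exists2 z : L0 P B, H z &
    {ae P, forall t, z t = inK k (ratr q) *: x t + inK k (1 - ratr q) *: y t}.
Proof.
move=> cH /andP[q0]; rewrite -(ler_rat R) rmorph1 => q1 Hx Hy.
have cstE a : {ae P, forall t, L0R_cst P a t = a} by exact: mfun_piE.
pose xi := L0R_cst P (ratr q); pose eta := L0R_cst P (1 - ratr q).
exists (L0_add (L0_scale xi x) (L0_scale eta y)).
  apply: cH => //.
  - by apply: filterS (cstE (ratr q)) => t ->; rewrite ler0q.
  - by apply: filterS (cstE (1 - ratr q)) => t ->; rewrite subr_ge0.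
  - apply/mfun_eqP; near=> t; rewrite (near (L0R_addE xi eta) t)//.
    by rewrite !(near (cstE _) t)// addrC subrK.
near=> t.
rewrite (near (L0_addE (L0_scale xi x) (L0_scale eta y)) t)//.
rewrite (near (L0_scaleE xi x) t)// (near (L0_scaleE eta y) t)//.
by rewrite !(near (cstE _) t).
Unshelve. all: by end_near.
Qed.
End random_radius.

(** * Random normal structure of L^0(F,V) *)

Section main.
Context d (T : measurableType d) (R : realType) (P : probability T R).
Context {k : scalars} (B : normedModType (scalar_field R k)).

(** [exhaustion] covers each [E h] only up to a null set depending on h, but refuting a point missed
    by all [E (u n)] involves only the countable family [c], so the null sets can be united. *)
Lemma normal_structure_radius (V : set B) (H : set (L0 P B)) :
  normal_structure V -> H `<=` L0_in P V -> H !=set0 -> as_bounded H ->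
  L0_convex H ->
  exists u : nat -> L0 P B, (forall n, H (u n)) /\
    {ae P, forall t, (0 < random_diam H t)%E ->
      exists n, (random_radius H (u n) t < random_diam H t)%E}.
Proof.
move=> nV HV [h0 Hh0] bH cH.
have V0 : V !=set0 by case: nV.
have H0 : H !=set0 by exists h0.
pose I := {h | H h}.
pose E (h : I) := [set t | (random_radius H (sval h) t < random_diam H t)%E].
have [|u uP] := @exhaustion _ _ _ P I (exist _ h0 Hh0) E.
  move=> h; rewrite -[X in measurable X]setTI.
  by apply: measurable_lte => //; exact: measurable_L0bar.
exists (sval \o u); split=> [n|]; first exact: svalP.
have /choice[W WP] h := random_radius_seq h H0.
(* Closing one element of [H] under the operations [g] gives a sequence [c] *)
(* such that almost every [c ^~ t] is closed under rational convex *)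
(* combinations and itself realises the radius at each of its points. *)
have /choice[g gP] (p : (nat + rat) * (I * I)) : exists c : I, match p.1 with
    | inl n => sval c = W (sval p.2.1) n
    | inr q => 0 <= q <= 1 -> {ae P, forall t, sval c t =
        inK k (ratr q) *: sval p.2.1 t + inK k (1 - ratr q) *: sval p.2.2 t}
    end.
  case: p => [[n|q] [x y]] /=.
    by have [WH _ _] := WP (sval x); exists (exist _ _ (WH n)).
  have [q01|] := boolP (0 <= q <= 1); last by exists x.
  have [z Hz zE] := L0_convex_rat cH q01 (svalP x) (svalP y).
  by exists (exist _ z Hz).
have [c cP] := @countable_op_closure _ _ (exist _ h0 Hh0 : I)
  (fun i x y => g (i, (x, y))).
have Vc : {ae P, forall t m, V (sval (c m) t)}.
  by apply: ae_foralln => m; apply/(L0_inP _ V0)/HV/svalP.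
have cD : {ae P, forall t m n,
    ((rnorm (sval (c m) t - sval (c n) t))%:E <= random_diam H t)%E}.
  by do 2![apply: ae_foralln => ?]; apply: random_diam_ub; exact: svalP.
have cR : {ae P, forall t m, random_radius H (sval (c m)) t =
    ereal_sup (range (fun n =>
      (rnorm (sval (c m) t - W (sval (c m)) n t))%:E))}.
  by apply: ae_foralln => m; have [] := WP (sval (c m)).
have cE : {ae P, forall t m, E (c m) t -> exists n, E (u n) t}.
  by apply: ae_foralln => m; exact: uP.
have cQ : {ae P, forall t (q : rat) m n, 0 <= q <= 1 -> exists j,
    sval (c j) t = inK k (ratr q) *: sval (c m) t +
                   inK k (1 - ratr q) *: sval (c n) t}.
  apply: ae_forall_countable => q.
  apply: ae_foralln => m; apply: ae_foralln => n.
  have [q01|] := boolP (0 <= q <= 1); last by move=> _; exact: aeW.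
  have [j cj] := cP (inr q) m n.
  by apply: filterS (gP (inr q, (c m, c n)) q01) => t; rewrite -cj; exists j.
near=> t => D0; apply: contrapT => nE.
have Doo : (random_diam H t < +oo)%E by near: t; exact: random_diam_lty.
have DE : random_diam H t = (fine (random_diam H t))%:E.
  by rewrite fineK// ge0_fin_numE// ltW.
apply: (@normal_structure_no_diametral_seq _ _ _ V (fun m => sval (c m) t)
  (fine (random_diam H t)) nV).
- by rewrite -lte_fin -DE.
- by near: t.
- by move=> m n; rewrite -lee_fin -DE; apply: (near cD t).
- move=> m e; rewrite -lte_fin -DE => eD.
  (* At the missed point the radius at [c m] is not below the diameter, so some [W (sval (c m)) n]
     is farther than [e] from [c m]; by closure under [inl n] it is again a term of [c]. *)
  have /negP : ~ E (c m) t by move=> Em; apply: nE; apply: (near cE t) Em.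
  rewrite -leNgt => /(lt_le_trans eD); rewrite (near cR t)//.
  move=> /ereal_sup_gt[_ [n _ <-]]; rewrite lte_fin => en.
  have [j cj] := cP (inl n) m m.
  by exists j; rewrite cj (gP (inl n, (c m, c m))).
- by near: t.
Unshelve. all: by end_near.
Qed.

Lemma L0_in_random_normal_structure (V : set B) :
  normal_structure V -> random_normal_structure (L0_in P V).
Proof.
move=> nV; have [V0 clV cV _] := nV.
split.
- have [v Vv] := V0; exists (\pi_(L0 P B) (StrongRE (strong_cst T v))).
  apply/(L0_inP _ V0).
  by apply: filterS (L0_piE P (StrongRE (strong_cst T v))) => t ->.
- exact: closed_L0_in.
- exact: L0_convex_L0_in.
move=> H HV H0 clH bH cH _.
have [u [Hu uD]] := normal_structure_radius nV HV H0 bH cH.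
pose E n := [set t | (random_radius H (u n) t < random_diam H t)%E].
have [|N mN NE] := @measurable_hitting_index _ T E.
  move=> n; rewrite -[X in measurable X]setTI.
  by apply: measurable_lte => //; exact: measurable_L0bar.
have [z Hz zE] := closed_L0_convex_glue cH clH mN Hu.
(* At almost every t with positive diameter, [z t] is the value of some [u n] with [E n t]. The
   radius at [z] is a supremum over the sequence [w], so it is bounded by the radius at that [u n],
   using the countably many comparisons in [uw]. *)
have [w [Hw wE _]] := random_radius_seq z H0.
have uw : {ae P, forall t n m,
    ((rnorm (u n t - w m t))%:E <= random_radius H (u n) t)%E}.
  apply: ae_foralln => n; apply: ae_foralln => m.
  by have [? [_ _]] := random_radius_seq (u n) H0; exact.
exists z => //; near=> t => /= D0.
have [n En] : exists n, E n t by apply: (near uD t).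
apply: le_lt_trans (NE _ _ En).
rewrite -/(random_radius H z) (near wE t)//.
apply: ge_ereal_sup => _ [m _ <-].
by rewrite (near zE t)//; apply: (near uw t).
Unshelve. all: by end_near.
Qed.
End main.

Theorem theorem2p16 (d : measure_display) (T : measurableType d) (R : realType)
    (P : probability T R) (k : scalars)
    (B : completeNormedModType (scalar_field R k)) (V : set B)
    (V_compact : weakly_compact V) (V_convex : convex_set V)
    (V_normal : normal_structure V) :
  random_normal_structure (L0_in P V).
Proof. exact: L0_in_random_normal_structure. Qed.
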